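(* Let $n\ge 4$ and let $S=\{x,y,z,w\}$ be a set of four distinct vertices of $D_n$ such that the vertices of $S$ lie in exactly two clusters of $D_n$. Then there exist $n-1$ internally disjoint $S$-trees in $D_n$.
   Context: The $n$-dimensional dual cube $D_n$ has vertex set all $(2n-1)$-bit binary strings $u_1u_2\cdots u_{2n-1}$. Two vertices $u,v$ are adjacent iff they differ in exactly one bit position $i$, and moreover: if $1\le i\le n-1$ then $u_{2n-1}=v_{2n-1}=0$; if $n\le i\le 2n-2$ then $u_{2n-1}=v_{2n-1}=1$; (if $i=2n-1$ there is no further condition). A cluster of class $0$ is a set of all vertices with last bit $0$ and a fixed value of the bits in positions $n,\dots,2n-2$; a cluster of class $1$ is a set of all vertices with last bit $1$ and a fixed value of the bits in positions $1,\dots,n-1$. The clusters partition $V(D_n)$. For $S\subseteq V(G)$, an $S$-tree is a subtree of $G$ whose vertex set contains $S$; a family of $S$-trees $T_1,\dots,T_m$ is internally disjoint if the trees are pairwise edge-disjoint and $V(T_i)\cap V(T_j)=S$ for all $i\ne j$. *)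

(* Defs.v *)
From HB Require Import structures.
From mathcomp Require Import all_boot.
Set Implicit Arguments. Unset Strict Implicit. Unset Printing Implicit Defensive.

(* Vertices of D_n: (2n-1)-bit strings u_1 ... u_{2n-1}.  Bit u_k (1-based)
   is stored at index k-1 of 'I_(2n-1). *)
Definition vert (n : nat) := {ffun 'I_(n.*2.-1) -> bool}.

(* bit u k = u_{k+1} (0-based access), false if out of range *)
Definition bit n (u : vert n) (k : nat) : bool :=
  if insub k is Some j then u j else false.

Definition lastbit n (u : vert n) : bool := bit u (n.*2 - 2).

(* adjacency in D_n: u, v differ in exactly one (0-based) position i, and
   - if 1 <= i+1 <= n-1 (i.e. i < n-1) then u_{2n-1} = v_{2n-1} = 0
   - if n <= i+1 <= 2n-2 (i.e. n-1 <= i < 2n-2) then u_{2n-1} = v_{2n-1} = 1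
   - if i+1 = 2n-1 no further condition *)
Definition dc_adj n (u v : vert n) : bool :=
  [exists i : 'I_(n.*2.-1),
     [forall j : 'I_(n.*2.-1), (u j != v j) == (j == i)] &&
     (if i < n - 1 then ~~ lastbit u && ~~ lastbit v
      else if i < n.*2 - 2 then lastbit u && lastbit v
      else true)].

(* u and v lie in the same cluster: same last bit b, and
   b = 0: agree on positions n..2n-2 (0-based n-1..2n-3);
   b = 1: agree on positions 1..n-1 (0-based 0..n-2). *)
Definition same_cluster n (u v : vert n) : bool :=
  (lastbit u == lastbit v) &&
  [forall j : 'I_(n.*2.-1),
     (if lastbit u then j < n - 1 else (n - 1 <= j) && (j < n.*2 - 2))
     ==> (u j == v j)].

Definition cluster n (u : vert n) : {set vert n} := [set v | same_cluster u v].

Definition edge_rel n (ET : {set {set vert n}}) : rel (vert n) :=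
  fun u v => [set u; v] \in ET.

Definition is_subtree n (VT : {set vert n}) (ET : {set {set vert n}}) : Prop :=
  [/\ (forall e, e \in ET ->
         exists u v, [/\ e = [set u; v], dc_adj u v, u \in VT & v \in VT]),
      VT != set0,
      (forall u v, u \in VT -> v \in VT -> connect (edge_rel ET) u v) &
      (forall c : seq (vert n), uniq c -> 2 < size c -> ~~ cycle (edge_rel ET) c)].

Definition is_Stree n (S : {set vert n}) (VT : {set vert n})
  (ET : {set {set vert n}}) : Prop :=
  is_subtree VT ET /\ S \subset VT.

Definition internally_disjoint_Strees n (S : {set vert n}) (m : nat)
  (T : 'I_m -> {set vert n} * {set {set vert n}}) : Prop :=
  (forall i, is_Stree S (T i).1 (T i).2) /\
  (forall i j, i != j -> (T i).2 :&: (T j).2 = set0 /\ (T i).1 :&: (T j).1 = S).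

(* Main.v *)
Require Import Defs.
From HB Require Import structures.
From mathcomp Require Import all_boot.

(** Write n = m + 1.  A vertex is a triple (c, o, t): class c, name o of its
    cluster, position t in that cluster, with o and t in the m-cube.  Inside a
    cluster one bit of t is flipped, and the remaining edge is (c, o, t) --
    (~ c, t, o); hence any two clusters of different classes are joined by
    exactly one edge.

    Colour all clusters other than the two that meet S by m colours, both classes
    receiving every colour.  The union of the clusters of one colour i is
    connected, and T_i is a spanning tree of this union enlarged by S and by the
    vertices of the two special clusters whose cross neighbour has colour i.  The
    vertices outside S are thus distributed among the trees, and all that is
    needed is a colouring f of the cluster names, i.e. of the m-cube, for which
    every vertex p of S reaches each colour: essentially, all colours must occur
    in the closed neighbourhood of p away from S.

    Such colourings exist by induction on m.  If some direction d separates no two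
    of the (at most four) relevant points at distance at most 2, delete the
    coordinate d and give a new colour to the neighbours of the points in direction
    d.  Close pairs span a forest with at most three edges, each using at most two
    directions, so only m <= 6 escapes; there, up to translation and permutation
    of the coordinates, few configurations remain and a backtracking search settles
    them. *)

Set Implicit Arguments. Unset Strict Implicit. Unset Printing Implicit Defensive.

(** * Colourings of the cube *)

Notation pt := (seq bool).

Definition flip d (p : pt) : pt :=
  mkseq (fun k => nth false p k (+) (k == d)) (size p).

Definition nhd m p := p :: [seq flip d p | d <- iota 0 m].

(* In the next three definitions [f] colours the cluster names, [X] is the set of
   positions of S in a special cluster, and [H] ("hole") holds of the name of the other
   special cluster, which has no colour of its own.  A vertex whose cross neighbour
   lies in the hole can still join colour [i] through a neighbour outside S. *)
Definition exits m (f : pt -> nat) (X H : pred pt) i q :=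
  if H q then has (fun u => [&& ~~ X u, ~~ H u & f u == i]) (nhd m q) else true.

Definition direct m (f : pt -> nat) (X H : pred pt) p i :=
  has (fun q => if f q == i then ((q == p) || ~~ X q) && exits m f X H i q
                else false) (nhd m p).

(* An edge between two vertices of S in direction [d] belongs to colour [g d]. *)
Definition served m f (g : nat -> nat) (X H : pred pt) p i :=
  if direct m f X H p i then true else
  has (fun d => if X (flip d p)
                then (if g d == i then direct m f X H (flip d p) i else false)
                else false) (iota 0 m).

Definition solvable m (X1 X2 H : seq pt) :=
  exists f g, forall i p, i < m ->
    (p \in X1 -> served m f g (mem X1) (mem H) p i) /\
    (p \in X2 -> served m f g (mem X2) (mem H) p i).

Definition close m (p q : pt) :=
  count (fun k => nth false p k != nth false q k) (iota 0 m) <= 2.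

(** Two is the critical distance: a neighbour of one point can coincide with the neighbour of
    another in direction [d] only if the points are close. The conditional, unlike [||], lets
    call-by-value evaluation skip the test [close]. *)
Definition neutral m d (s : seq pt) :=
  all (fun p => all (fun q =>
    if nth false p d == nth false q d then true else ~~ close m p q) s) s.

Fixpoint lookup (s : seq (pt * nat)) (x : nat) (p : pt) : nat :=
  if s is (q, i) :: s' then (if q == p then i else lookup s' x p) else x.

Fixpoint first_some (A B : Type) (k : A -> option B) (s : seq A) : option B :=
  if s is x :: s' then
    (if k x is Some y then Some y else first_some k s')
  else None.

(** * Backtracking search for colourings *)

Section Search.
Variables (m : nat) (X1 X2 H : seq pt).

Definition side (b : bool) := if b then X2 else X1.

Definition edge_dirs : seq nat :=
  filter (fun d => has (fun p => flip d p \in X1) X1 || has (fun p => flip d p \in X2) X2)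
    (iota 0 m).
(** A fixed choice of [g], made before the search: distinct directions of edges inside the sets get
    distinct colours, and only the colouring of the points is left to be found. *)
Definition dir_colour d := index d edge_dirs.

Definition served_by (L : seq (pt * nat)) (t : bool * pt * nat) :=
  let: (b, p, i) := t in
  served m (lookup L m) dir_colour (mem (side b)) (mem H) p i.

Definition demands : seq (bool * pt * nat) :=
  [seq (false, p, i) | p <- X1, i <- iota 0 m] ++
  [seq (true, p, i) | p <- X2, i <- iota 0 m].

(* The junk colour [m] marks the points that have not been coloured yet. *)
Definition options (L : seq (pt * nat)) (t : bool * pt * nat) : seq (seq (pt * nat)) :=
  let: (b, p, i) := t in
  let X := side b in
  let free q := lookup L m q == m in
  let N := [seq flip d p | d <- iota 0 m] in
  [seq (q, i) :: L | q <- rcons N p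
     & [&& (q == p) || (q \notin X), q \notin H & free q]] ++
  (if has (fun d => (flip d p \in X) && (dir_colour d == i)) (iota 0 m) then [:: L] else [::]) ++
  [seq (q, i) :: (u, i) :: L | q <- [seq q <- H | [&& q \in N, q \notin X & free q]],
     u <- [seq u <- [seq flip d q | d <- iota 0 m]
          | (u \notin X) && (free u || (lookup L m u == i))]].

(** An unmet demand is met by colouring the point or a neighbour of it, by trusting an edge inside
    the set, or by colouring a neighbour in the hole together with an exit from it. A trusted edge
    is not verified at once, so all demands are tested again at the end; soundness rests on this
    test alone. *)
Fixpoint search (D : seq (bool * pt * nat)) (L : seq (pt * nat)) : option (seq (pt * nat)) :=
  if D is t :: D' then
    (if served_by L t then search D' L
     else first_some (search D') (options L t))
  else if all (served_by L) demands then Some L else None.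

Definition solve : bool := if search demands [::] is Some _ then true else false.
End Search.


Lemma size_flip d p : size (flip d p) = size p.
Proof. by rewrite size_mkseq. Qed.

Lemma nth_flip d p k : k < size p -> nth false (flip d p) k = nth false p k (+) (k == d).
Proof. by move=> lt; rewrite nth_mkseq. Qed.

Lemma mem_nhd m p q :
  reflect (q = p \/ exists2 d, d < m & q = flip d p) (q \in nhd m p).
Proof.
rewrite inE; apply: (iffP orP) => [[/eqP-> | /mapP[d]]|[-> | [d lt ->]]].
- by left.
- by rewrite mem_iota /= => lt ->; right; exists d.
- by left.
by right; apply: map_f; rewrite mem_iota.
Qed.

(** * Transfer of colourings between cubes *)

Section Lift.
Variables (m m' : nat) (f f' : pt -> nat) (g g' : nat -> nat).
Variables (X X' H H' P : pred pt) (r : pt -> pt) (t : nat -> nat).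

Let faithful q := [/\ f' q = f (r q), X q = X' (r q) & H q = H' (r q)].

Hypothesis PF : forall p, P p -> faithful p.
Hypothesis HP : forall p, H p -> P p.
Hypothesis XP : forall p d, P p -> X (flip d p) -> P (flip d p).
Hypothesis lift : forall p d, P p -> d < m ->
  [/\ t d < m', r (flip (t d) p) = flip d (r p) & faithful (flip (t d) p)].
Hypothesis gE : forall d, d < m -> g' (t d) = g d.

Lemma lift_nhd p q : P p -> q \in nhd m (r p) ->
  exists q', [/\ q' \in nhd m' p, r q' = q, q = r p -> q' = p & faithful q'].
Proof.
move=> Pp /mem_nhd qN; have [->|ne] := eqVneq q (r p).
  by exists p; split=> //; [apply/mem_nhd; left | apply: PF].
case: qN => [eq_q|[d lt eq_q]]; first by rewrite eq_q eqxx in ne.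
have [tl rE F] := lift Pp lt; exists (flip (t d) p); split=> //.
- by apply/mem_nhd; right; exists (t d).
- by rewrite rE.
by move=> eq_r; rewrite eq_r eqxx in ne.
Qed.

Lemma direct_lift p i : P p -> direct m f X' H' (r p) i -> direct m' f' X H p i.
Proof.
move=> Pp /hasP[q qN]; case: eqP => // fq /andP[qX qE].
have [q' [q'N rq q'p [f'E XE HE]]] := lift_nhd Pp qN.
apply/hasP; exists q' => //; rewrite f'E rq fq eqxx XE rq; apply/andP; split.
  by case/orP: qX => [/eqP/q'p-> | ->]; rewrite ?eqxx ?orbT.
move: qE; rewrite /exits HE rq; case: ifP => // Hq /hasP[u uN /and3P[uX uH /eqP fu]].
rewrite -rq in uN; have Pq' : P q' by apply: HP; rewrite HE rq.
have [u' [u'N ru _ [fE' XE' HE']]] := lift_nhd Pq' uN.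
by apply/hasP; exists u' => //; rewrite fE' XE' HE' ru fu uX uH eqxx.
Qed.

(** Symmetries of the cube, deletion of a coordinate and mere replacement of predicates are all
    instances. Agreement on [P] and its lifted neighbours suffices, since a path that serves [p] can
    leave [P] only in its last step: [HP] covers the step out of a hole and [XP] the step along an
    edge inside [X]. *)
Lemma served_lift p i :
  P p -> served m f g X' H' (r p) i -> served m' f' g' X H p i.
Proof.
rewrite /served => Pp; case: ifP => [dp _ | _ ]; first by rewrite direct_lift.
case: ifP => // _ /hasP[d]; rewrite mem_iota /= => lt.
have [tl rE [_ XE _]] := lift Pp lt.
case: ifP => // Xd; case: ifP => // gd dd; apply/hasP; exists (t d); first by rewrite mem_iota.
by rewrite XE rE Xd gE // gd direct_lift ?rE // XP // XE rE.
Qed.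
End Lift.

Lemma solvable_transfer m (r : pt -> pt) (t t' : nat -> nat) X1 X2 H :
  (forall p, p \in X1 ++ X2 ++ H -> size p = m) ->
  (forall p q, size p = m -> size q = m -> r p = r q -> p = q) ->
  (forall d, d < m -> t d < m) -> (forall d, d < m -> t' (t d) = d) ->
  (forall p d, size p = m -> d < m -> r (flip (t d) p) = flip d (r p)) ->
  solvable m (map r X1) (map r X2) (map r H) -> solvable m X1 X2 H.
Proof.
move=> sz inj tl tK rE [f [g sol]].
have mem_r Y q : {subset Y <= X1 ++ X2 ++ H} -> size q = m -> (q \in Y) = (r q \in map r Y).
  move=> sY sq; apply/idP/mapP => [qY|[q' q'Y /inj->//]]; first by exists q.
  exact: sz (sY _ _).
have s1 : {subset X1 <= X1 ++ X2 ++ H} by move=> q; rewrite !mem_cat => ->.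
have s2 : {subset X2 <= X1 ++ X2 ++ H} by move=> q; rewrite !mem_cat => ->; rewrite orbT.
have s3 : {subset H <= X1 ++ X2 ++ H} by move=> q; rewrite !mem_cat => ->; rewrite !orbT.
have key Y p i : {subset Y <= X1 ++ X2 ++ H} -> p \in Y ->
    served m f g (mem (map r Y)) (mem (map r H)) (r p) i ->
    served m (f \o r) (g \o t') (mem Y) (mem H) p i.
  move=> sY pY; apply: (@served_lift _ _ _ _ _ _ _ _ _ _ (fun q => size q == m) r t).
  - by move=> q /eqP sq; split=> //=; apply: mem_r.
  - by move=> q /s3/sz/eqP.
  - by move=> q d _ /sY/sz/eqP.
  - move=> q d /eqP sq lt; split; [exact: tl | exact: rE |].
    by split=> //=; apply: mem_r; rewrite ?size_flip.
  - by move=> d lt /=; rewrite tK.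
  by rewrite (sz _ (sY _ pY)).
exists (f \o r), (g \o t') => i p lt; have [k1 k2] := sol i (r p) lt.
by split=> pX; apply: key => //; [apply: k1 | apply: k2]; apply: map_f.
Qed.

Definition del d (p : pt) : pt :=
  mkseq (fun k => nth false p (bump d k)) (size p).-1.

Lemma nth_del d p k : k < (size p).-1 -> nth false (del d p) k = nth false p (bump d k).
Proof. by move=> lt; rewrite nth_mkseq. Qed.

Lemma eq_off_del m d p q : size p = m.+1 -> size q = m.+1 -> d < m.+1 ->
  del d p = del d q -> forall j, j < m.+1 -> j != d -> nth false p j = nth false q j.
Proof.
move=> sp sq ltd E j lt jd; have := congr1 (fun x => nth false x (unbump d j)) E.
have lt' : unbump d j < m.
  rewrite /unbump; case: (ltngtP d j) => [dj|jd'|e]; last by rewrite e eqxx in jd.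
    by rewrite subn1 -ltnS prednK // (leq_ltn_trans _ dj).
  by rewrite subn0 (leq_trans jd').
by rewrite !nth_del ?sp ?sq //= unbumpK // inE.
Qed.

Lemma close_off m d k p q :
  (forall j, j < m -> j != d -> j != k -> nth false p j = nth false q j) ->
  close m p q.
Proof.
move=> E; rewrite /close -size_filter; apply: (@uniq_leq_size _ _ [:: d; k]).
  exact: filter_uniq (iota_uniq _ _).
move=> j; rewrite mem_filter mem_iota !inE /= => /andP[ne lt].
by case: eqVneq => //= jd; case: eqVneq => // jk; rewrite E // eqxx in ne.
Qed.

Lemma neutralP m d s p q :
  neutral m d s -> p \in s -> q \in s -> close m p q -> nth false p d = nth false q d.
Proof. by move=> /allP h /h/allP h' /h'; case: eqP => // _ /negP. Qed.

(* Deleting a neutral direction: the neighbours in that direction get the new colour [m]. *)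
Lemma solvable_del m d X1 X2 H :
  let s := X1 ++ X2 ++ H in
  d < m.+1 -> (forall p, p \in s -> size p = m.+1) -> neutral m.+1 d s ->
  solvable m (map (del d) X1) (map (del d) X2) (map (del d) H) ->
  solvable m.+1 X1 X2 H.
Proof.
move=> s ltd sz neu [f [g sol]].
(* [p] and [p0] differ at most in [d] and [k], so they are close, and neutrality makes them agree in
   [d]. *)
have near p k q p0 : p \in s -> p0 \in s -> k != d -> size q = m.+1 ->
    (forall j, j < m.+1 -> j != k -> nth false q j = nth false p j) ->
    (forall j, j < m.+1 -> j != d -> nth false q j = nth false p0 j) ->
    q = p0.
  move=> ps p0s kd sq qp qp0; apply: (@eq_from_nth _ false); rewrite sq ?sz // => j lt.
  have [->|] := eqVneq j d; last exact: qp0.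
  rewrite qp // 1?eq_sym //; apply: (neutralP neu) => //.
  by apply: (@close_off _ d k) => i lti id ik; rewrite -qp // qp0.
have delE q p0 : size q = m.+1 -> p0 \in s -> del d q = del d p0 ->
    forall j, j < m.+1 -> j != d -> nth false q j = nth false p0 j.
  by move=> sq p0s; apply: eq_off_del => //; apply: sz.
pose N := map (flip d) (X1 ++ X2).
pose f' q := if q \in N then m else f (del d q).
have mem_d Y p k q : {subset Y <= s} -> p \in s -> k != d -> size q = m.+1 ->
    (forall j, j < m.+1 -> j != k -> nth false q j = nth false p j) ->
    (q \in Y) = (del d q \in map (del d) Y).
  move=> sY ps kd sq qp; apply/idP/mapP => [qY|[q' q'Y E]]; first by exists q.
  by rewrite (near p k q q') // ?sY //; apply: delE => //; apply: sY.
(* A step in a direction other than [d] never lands on a newly coloured point: by [near] the point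
   [flip d p0] would be [p0] itself. *)
have f'E p k q : p \in s -> k != d -> size q = m.+1 ->
    (forall j, j < m.+1 -> j != k -> nth false q j = nth false p j) ->
    f' q = f (del d q).
  move=> ps kd sq qp; rewrite /f'; case: ifP => // /mapP[p0 p0X qE].
  have p0s : p0 \in s by rewrite /s catA mem_cat p0X.
  have E : q = p0.
    apply: (near p k q p0) => // j lt jd.
    by rewrite qE nth_flip ?sz // (negbTE jd) addbF.
  have := congr1 (fun x => nth false x d) qE.
  by rewrite E nth_flip ?sz // eqxx; case: (nth _ _ _).
have s1 : {subset X1 <= s} by move=> q; rewrite !mem_cat => ->.
have s2 : {subset X2 <= s} by move=> q; rewrite !mem_cat => ->; rewrite orbT.
have s3 : {subset H <= s} by move=> q; rewrite !mem_cat => ->; rewrite !orbT.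
have flip_out p : p \in s -> flip d p \notin s.
  move=> ps; apply/negP => fs.
  have c : close m.+1 p (flip d p).
    by apply: (@close_off _ d d) => j lt jd _; rewrite nth_flip ?sz // (negbTE jd) addbF.
  have := neutralP neu ps fs c; rewrite nth_flip ?sz // eqxx.
  by case: (nth _ _ _).
have key Y p i : {subset Y <= s} -> p \in Y ->
    served m f g (mem (map (del d) Y)) (mem (map (del d) H)) (del d p) i ->
    served m.+1 f' (g \o unbump d) (mem Y) (mem H) p i.
  move=> sY pY; apply: (@served_lift _ _ _ _ _ _ _ _ _ _ (mem s) (del d) (bump d)) => /=.
  (* No step is made here, so any number other than [d] may stand for the direction. *)
  - move=> q qs; have kd : d.+1 != d by rewrite neq_ltn ltnSn orbT.
    by split; [apply: (f'E q d.+1) | apply: (mem_d _ q d.+1) | apply: (mem_d _ q d.+1)];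
      rewrite ?sz.
  - exact: s3.
  - by move=> q k _ /sY.
  - move=> q k qs ltk; have kd := neq_bump d k; rewrite eq_sym in kd.
    have off j : j < m.+1 -> j != bump d k -> nth false (flip (bump d k) q) j = nth false q j.
      by move=> lt ne; rewrite nth_flip ?sz // (negbTE ne) addbF.
    split.
    + by rewrite /bump; case: (d <= k) => //; rewrite add0n ltnW.
    + apply: (@eq_from_nth _ false) => [|j].
        by rewrite size_flip !size_mkseq.
      rewrite size_mkseq size_flip sz //=.
      move=> lt; have ltb : bump d j < m.+1.
        by rewrite /bump; case: (d <= j) => //; rewrite add0n ltnW.
      rewrite nth_del ?size_flip ?sz // !nth_flip ?size_mkseq ?sz // nth_mkseq ?sz //.
      by rewrite (inj_eq (can_inj (@bumpK d))).
    + by split; [apply: (f'E q (bump d k)) | apply: (mem_d _ q (bump d k)) | 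
        apply: (mem_d _ q (bump d k))]; rewrite ?size_flip ?sz.
  - by move=> k _; rewrite bumpK.
  exact: sY.
(* The neighbour of [p] in direction [d] has the new colour and, by [flip_out], avoids both the sets
   and the hole. *)
have new Y p : {subset Y <= X1 ++ X2} -> p \in Y ->
    served m.+1 f' (g \o unbump d) (mem Y) (mem H) p m.
  move=> sY pY; have ps : p \in s by rewrite /s catA mem_cat sY.
  rewrite /served; case: ifP => // /hasP[]; exists (flip d p); first by apply/mem_nhd; right; exists d.
  have fN : flip d p \in N by apply/map_f/sY.
  have fo := flip_out p ps.
  rewrite /f' fN eqxx /exits; case: ifP => /= [fH|_]; first by rewrite (s3 _ fH) in fo.
  rewrite andbT (contra _ fo) ?orbT // => fY.
  by rewrite /s catA mem_cat sY.
exists f', (g \o unbump d) => i p; rewrite ltnS leq_eqVlt => /predU1P[-> | lt].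
  by split=> pX; apply: new => // q; rewrite mem_cat => ->; rewrite ?orbT.
have [k1 k2] := sol i (del d p) lt.
by split=> pX; apply: key => //; [apply: k1 | apply: k2]; apply: map_f.
Qed.

(** * Configurations in small dimension *)

Fixpoint all_sorted k lo (hi : nat) (P : seq nat -> bool) : bool :=
  if k is k'.+1 then
    all (fun x => all_sorted k' x hi (fun s => P (x :: s))) (iota lo (hi - lo))
  else P [::].

Lemma all_sortedP k lo hi P s :
  all_sorted k lo hi P -> size s = k -> path leq lo s -> all (ltn^~ hi) s -> P s.
Proof.
elim: k lo P s => [|k IH] lo P [|x s] //= /allP allx [sz] /andP[lox pth] /andP[xhi hs].
apply: (IH x (fun s => P (x :: s))) => //; apply: allx.
by rewrite mem_iota lox subnKC // (leq_trans lox (ltnW xhi)).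
Qed.

(* A configuration is encoded by one number per coordinate, whose binary digits are
   the values of the points there; the first point is 0 and is omitted. *)
Definition column (s : seq pt) k : nat :=
  foldr (fun p acc => nth false p k + acc.*2) 0 s.

Definition of_columns m r (c : seq nat) : seq pt :=
  nseq m false :: [seq [seq odd (iter j half x) | x <- c] | j <- iota 0 r].

Lemma column_lt s k : column s k < 2 ^ size s.
Proof.
elim: s => //= p s IH; rewrite expnS mul2n.
apply: leq_trans (_ : (column s k).+1.*2 <= _); last by rewrite leq_double.
by rewrite doubleS; case: (nth _ _ _); rewrite ?add1n ?add0n // ltnS leqnSn.
Qed.

Lemma column_bit s k j : j < size s ->
  odd (iter j half (column s k)) = nth false (nth [::] s j) k.
Proof.
elim: s j => // p s IH [|j]; first by rewrite /= oddD odd_double addbF oddb.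
by rewrite ltnS iterSr /= half_bit_double => /IH.
Qed.

(* Coordinates permuted by [o], then translated so that [s0] becomes 0. *)
Definition reframe (o : seq nat) (s0 p : pt) : pt :=
  [seq nth false p k (+) nth false s0 k | k <- o].

Lemma nth_reframe o s0 p k : k < size o ->
  nth false (reframe o s0 p) k = nth false p (nth 0 o k) (+) nth false s0 (nth 0 o k).
Proof. exact: nth_map. Qed.

Lemma size_reframe o s0 p : size (reframe o s0 p) = size o.
Proof. exact: size_map. Qed.

Lemma reframe_inj m o s0 p q :
  perm_eq o (iota 0 m) -> size p = m -> size q = m ->
  reframe o s0 p = reframe o s0 q -> p = q.
Proof.
move=> po sp sq E; apply: (@eq_from_nth _ false) => [|k]; rewrite sp ?sq // => lt.
have ko : k \in o by rewrite (perm_mem po) mem_iota.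
have := congr1 (fun x => nth false x (index k o)) E.
by rewrite !nth_reframe ?index_mem // !nth_index // => /addIb.
Qed.

Lemma solvable_reframe m o s0 X1 X2 H :
  perm_eq o (iota 0 m) -> (forall p, p \in X1 ++ X2 ++ H -> size p = m) ->
  solvable m (map (reframe o s0) X1) (map (reframe o s0) X2) (map (reframe o s0) H) ->
  solvable m X1 X2 H.
Proof.
move=> po sz; have so : size o = m by rewrite (perm_size po) size_iota.
have uo : uniq o by rewrite (perm_uniq po) iota_uniq.
have mo k : (k \in o) = (k < m) by rewrite (perm_mem po) mem_iota.
apply: (@solvable_transfer m _ (nth 0 o) (index^~ o)) => //.
- by move=> p q; apply: reframe_inj.
- by move=> d lt; rewrite -mo mem_nth ?so.
- by move=> d lt; rewrite index_uniq ?so.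
move=> p d sp lt; apply: (@eq_from_nth _ false) => [|k].
  by rewrite size_flip !size_reframe.
rewrite size_reframe => ltk; rewrite nth_flip ?size_reframe // !nth_reframe //.
have ltm : nth 0 o k < m by rewrite -mo mem_nth.
by rewrite nth_flip ?sp // nth_uniq -?so ?so // 1?addbAC // -so.
Qed.

(** A neutral direction allows the dimension to be lowered, so the search runs only without one, or
    in dimension 3, where the induction starts. Repetitions are excluded within each set only:
    vertices of different clusters may share a position. *)
Definition base_ok m k1 k2 (s : seq pt) : bool :=
  let X1 := take k1 s in let X2 := take k2 (drop k1 s) in
  let H := drop (k1 + k2) s in
  if uniq X1 && uniq X2 then
    (if (if 3 < m then has (fun d => neutral m d s) (iota 0 m) else false) then true
     else solve m X1 X2 H)
  else true.

(** Nondecreasing sequences of columns suffice, because a permutation of the coordinates sorts them.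
    The predecessor accounts for the first point, which is translated to 0. *)
Definition base m k1 k2 r : bool :=
  let r' := (k1 + k2 + r).-1 in
  all_sorted m 0 (2 ^ r') (fun c => base_ok m k1 k2 (of_columns m r' c)).

(* The numbers of points of S in the first and the second set, and of holes. *)
Definition shapes := [:: (2, 2, 0); (3, 1, 0); (3, 0, 1); (2, 0, 1); (1, 0, 1)].

(** Dimension 6 is the last one to check: a forest on at most four points has at most three edges,
    hence uses at most six directions, and from dimension 7 on a neutral direction always exists. *)
Lemma base_small :
  all (fun m => all (fun t : nat * nat * nat => let: (k1, k2, r) := t in base m k1 k2 r) shapes)
    [:: 3; 4; 5; 6].
Proof. by vm_compute. Qed.

Lemma first_someP (A B : Type) (k : A -> option B) s y :
  first_some k s = Some y -> exists x, k x = Some y.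
Proof. by elim: s => //= x s IH; case E: (k x) => [z|] // [<-]; exists x. Qed.

Lemma solveP m X1 X2 H : solve m X1 X2 H -> solvable m X1 X2 H.
Proof.
rewrite /solve; case E: search => [L|] // _.
have final D L0 : search m X1 X2 H D L0 = Some L ->
    all (served_by m X1 X2 H L) (demands m X1 X2).
  elim: D L0 => [|t D IH] L0 /=; first by case: ifP => // ok [<-].
  by case: ifP => _; [apply: IH | move=> fE; have [L1] := first_someP fE; apply: IH].
have {E final} /allP ok := final _ _ E.
exists (lookup L m), (dir_colour m X1 X2) => i p lt.
have mi : i \in iota 0 m by rewrite mem_iota.
split=> pX; [apply: (ok (false, p, i)) | apply: (ok (true, p, i))]; rewrite mem_cat.
  by apply/orP; left; apply/allpairsP; exists (p, i).
by apply/orP; right; apply/allpairsP; exists (p, i).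
Qed.

(* Kruskal's algorithm on the closeness graph: each merging of two classes costs
   at most two directions. *)
Lemma merge_close m (s : seq pt) (E : seq (pt * pt)) :
  (forall e, e \in E -> [/\ e.1 \in s, e.2 \in s & close m e.1 e.2]) ->
  exists rep D, [/\ size D + (size (undup (map rep s))).*2 <= (size s).*2,
    forall e, e \in E -> rep e.1 = rep e.2 &
    forall d p, d < m -> d \notin D -> p \in s -> nth false p d = nth false (rep p) d].
Proof.
elim: E => [|[x y] E IH] hE.
  exists id, [::]; split=> //; rewrite map_id leq_double; exact: size_undup.
have [e eE|rep [D [szD repE bitE]]] := IH; first by apply: hE; rewrite inE eE orbT.
have [/= xs ys xy] := hE (x, y) (mem_head _ _).
have [rxy|rxy] := eqVneq (rep x) (rep y).
  by exists rep, D; split=> // e; rewrite inE => /predU1P[-> | /repE].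
pose rep' p := if rep p == rep x then rep y else rep p.
exists rep', ([seq k <- iota 0 m | nth false x k != nth false y k] ++ D); split.
- rewrite size_cat -addnA; apply: leq_trans szD.
  rewrite size_filter addnCA leq_add2l.
  apply: leq_trans (leq_add xy (leqnn _)) _.
  rewrite add2n -doubleS leq_double.
  (* No point is represented by [rep x] any more: the loss of one representative pays for the at
     most two new directions. *)
  apply: leq_trans (_ : (size (rem (rep x) (undup (map rep s)))).+1 <= _).
    rewrite ltnS; apply: uniq_leq_size (undup_uniq _) _ => q.
    rewrite mem_undup (rem_filter _ (undup_uniq _)) mem_filter mem_undup /=.
    case/mapP=> p ps ->; rewrite /rep'; case: ifP => [_|/negbT ->].
      by rewrite eq_sym rxy map_f.
    by rewrite map_f.
  have rx : rep x \in undup (map rep s) by rewrite mem_undup map_f.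
  by rewrite size_rem // prednK //; case: (undup _) rx.
- move=> e; rewrite inE /rep' => /predU1P[-> /=|/repE->//].
  by rewrite eqxx; case: ifP.
move=> d p lt; rewrite mem_cat negb_or mem_filter mem_iota add0n lt /= andbT negbK => /andP[/eqP bxy dD] ps.
rewrite /rep'; case: eqP => [rpx|_]; last exact: bitE.
by rewrite bitE // rpx -bitE // bxy bitE.
Qed.

(** At least one class survives the merging when [s] is nonempty, so [D] has at most
    [(size s).-1.*2] directions. A direction outside [D] is constant on each class, and close points
    share a class. *)
Lemma neutral_exists m (s : seq pt) :
  (size s).-1.*2 < m -> exists2 d, d < m & neutral m d s.
Proof.
move=> ltm; pose E := [seq e <- [seq (p, q) | p <- s, q <- s] | close m e.1 e.2].
have [e|rep [D [szD repE bitE]]] := @merge_close m s E.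
  by rewrite mem_filter => /andP[ce /allpairsP[[p q] /= [ps qs eE]]]; move: ce; rewrite eE.
have [d dm dD] : exists2 d, d < m & d \notin D \/ s = [::].
  case: s => [|x s] in ltm szD {E repE bitE} *; first by exists 0; [exact: ltm | right].
  have : has (fun d => d \notin D) (iota 0 m).
    apply: contraLR ltm => /hasPn sD; rewrite -leqNgt /= -(size_iota 0 m).
    apply: leq_trans (uniq_leq_size (iota_uniq 0 m) (s2 := D) _) _.
      by move=> d /sD; rewrite negbK.
    rewrite -(leq_add2r 2) [X in _ <= X]addn2 -doubleS; apply: leq_trans szD.
    rewrite leq_add2l (leq_double 1) lt0n size_eq0.
    by apply/eqP => u0; have := mem_undup (map rep (x :: s)) (rep x); rewrite u0 inE eqxx.
  by case/hasP=> d; rewrite mem_iota => dm dD; exists d => //; left.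
exists d => //; apply/allP => p ps; apply/allP => q qs; case: ifP => // /eqP ne.
apply/negP => c; case: dD => [dD|s0]; last by rewrite s0 in ps.
apply: ne; rewrite bitE // (bitE d q) //; congr nth.
by apply: (repE (p, q)); rewrite mem_filter /= c; apply/allpairsP; exists (p, q).
Qed.

Lemma size_del d p : size (del d p) = (size p).-1.
Proof. exact: size_mkseq. Qed.

Definition well_shaped m k1 k2 r (s : seq pt) :=
  [/\ size s = k1 + k2 + r, all (fun p => size p == m) s,
      uniq (take k1 s) & uniq (take k2 (drop k1 s))].

Definition solvable_at m k1 k2 s := solvable m (take k1 s) (take k2 (drop k1 s)) (drop (k1 + k2) s).

Lemma parts_cat k1 k2 (s : seq pt) :
  take k1 s ++ take k2 (drop k1 s) ++ drop (k1 + k2) s = s.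
Proof. by rewrite [k1 + k2]addnC -drop_drop !cat_take_drop. Qed.

Lemma well_shaped_map m m' k1 k2 r (h : pt -> pt) s :
  (forall p, size p = m -> size (h p) = m') -> {in s &, injective h} ->
  well_shaped m k1 k2 r s -> well_shaped m' k1 k2 r (map h s).
Proof.
move=> szh inj [sz /allP szm u1 u2]; split.
- by rewrite size_map.
- by rewrite all_map; apply/allP => p ps /=; rewrite szh //; apply/eqP/szm.
- rewrite -map_take map_inj_in_uniq // => p q /mem_take ps /mem_take qs; exact: inj.
rewrite -map_drop -map_take map_inj_in_uniq // => p q /mem_take/mem_drop ps /mem_take/mem_drop qs.
exact: inj.
Qed.

(** Deletion is injective on [s], since two points that differ only in direction [d] would be close
    and yet separated by it; hence the shape is preserved. *)
Lemma solvable_neutral m d k1 k2 r s :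
  d < m.+1 -> neutral m.+1 d s -> well_shaped m.+1 k1 k2 r s ->
  (forall s', well_shaped m k1 k2 r s' -> solvable_at m k1 k2 s') ->
  solvable_at m.+1 k1 k2 s.
Proof.
move=> lt neu prop IH; have [_ /allP szs _ _] := prop.
have sz p : p \in s -> size p = m.+1 by move/szs/eqP.
apply: (@solvable_del m d) => //; rewrite ?parts_cat //.
rewrite !map_take !map_drop; apply: IH; apply: well_shaped_map prop.
  by move=> p sp; rewrite size_del sp.
move=> p q ps qs E.
have off j : j < m.+1 -> j != d -> nth false p j = nth false q j.
  by apply: eq_off_del => //; apply: sz.
apply: (@eq_from_nth _ false) => [|j]; rewrite ?sz // => ltj.
have [->|] := eqVneq j d; last exact: off.
by apply: (neutralP neu) => //; apply: (@close_off _ d d) => i lti id _; apply: off.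
Qed.

(** Translating the first point to 0 and sorting the coordinates by their columns brings [s] into
    the form enumerated by [base]. *)
Lemma solvable_base m k1 k2 r s : 0 < k1 ->
  base m.+1 k1 k2 r -> well_shaped m.+1 k1 k2 r s ->
  (2 < m -> forall s', well_shaped m k1 k2 r s' -> solvable_at m k1 k2 s') ->
  solvable_at m.+1 k1 k2 s.
Proof.
set M := m.+1 => k1_gt0 bs prop IH; have [szs /allP szM _ _] := prop.
case: s => [|s0 s1] in szs szM prop *.
  by move: k1_gt0 szs; case: k1 {bs prop IH}.
have sz p : p \in s0 :: s1 -> size p = M by move/szM/eqP.
pose key := column [seq reframe (iota 0 M) s0 p | p <- s1].
pose o := sort (relpre key leq) (iota 0 M).
have po : perm_eq o (iota 0 M) by rewrite perm_sort.
have so : size o = M by rewrite (perm_size po) size_iota.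
pose s' := map (reframe o s0) (s0 :: s1).
suff sol : solvable_at M k1 k2 s'.
  apply: (@solvable_reframe M o s0) => //; first by rewrite parts_cat.
  by rewrite !map_take !map_drop.
have prop' : well_shaped M k1 k2 r s'.
  apply: well_shaped_map prop => [p sp|p q ps qs E]; first by rewrite size_reframe.
  exact: reframe_inj po (sz _ ps) (sz _ qs) E.
have s'E : s' = of_columns M (size s1) (map key o).
  rewrite /s' /of_columns [map _ (_ :: _)]/=; congr (_ :: _).
    apply: (@eq_from_nth _ false) => [|k]; rewrite size_reframe -?so ?size_nseq // => lt.
    by rewrite nth_reframe // addbb nth_nseq if_same.
  apply: (@eq_from_nth _ [::]) => [|j]; rewrite !size_map ?size_iota // => ltj.
  rewrite !(nth_map [::]) // (nth_map 0) ?size_iota // nth_iota // add0n.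
  rewrite -map_comp; apply/eq_in_map => k; rewrite (perm_mem po) mem_iota add0n => /= ltk.
  rewrite column_bit ?size_map // (nth_map [::]) // nth_reframe ?size_iota //.
  by rewrite nth_iota.
have := all_sortedP (s := map key o) bs.
rewrite size_map -szs /= -s'E => /(_ so) H.
have : base_ok M k1 k2 s'.
  apply: H.
    have : sorted leq (map key o) by rewrite /o -sort_map sort_sorted //; apply: leq_total.
    by case: (map key o).
  rewrite all_map; apply/allP => k _ /=.
  by rewrite -(size_map (reframe (iota 0 M) s0)) column_lt.
rewrite /base_ok; have [_ _ -> ->] := prop'; rewrite [true && true]/=.
case: ifP => [|_ /solveP//]; case: ifP => // m3 /hasP[d]; rewrite mem_iota => ltd neu _.
by apply: (@solvable_neutral m d k1 k2 r) => //; apply: IH.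
Qed.

Theorem solvable_shapes m k1 k2 r s :
  2 < m -> (k1, k2, r) \in shapes -> well_shaped m k1 k2 r s -> solvable_at m k1 k2 s.
Proof.
move=> m2 sh; elim: m m2 s => // m IH m2 s prop.
have [m6|m6] := ltnP m 6.
  have k1_gt0 : 0 < k1 by move: sh; rewrite !inE => /or4P[||| /orP[]] /eqP[->].
  apply: (@solvable_base m k1 k2 r) => //.
  have m_in : m.+1 \in [:: 3; 4; 5; 6].
    by case: m m2 m6 {IH prop} => [|[|[|[|[|[|m]]]]]].
  by have /allP/(_ _ sh) := allP base_small _ m_in.
have [d lt neu] : exists2 d, d < m.+1 & neutral m.+1 d s.
  apply: neutral_exists; have [-> _ _ _] := prop.
  by rewrite ltnS; apply: leq_trans m6; move: sh; rewrite !inE => /or4P[||| /orP[]] /eqP[-> -> ->].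
apply: (@solvable_neutral m d k1 k2 r) => // s' prop'.
by apply: IH => //; apply: leq_trans m6.
Qed.

(** * Spanning trees *)

Lemma set2_inj (T : finType) (a b c d : T) :
  [set a; b] = [set c; d] -> (a = c /\ b = d) \/ (a = d /\ b = c).
Proof.
move=> E.
have /set2P A : a \in [set c; d] by rewrite -E set21.
have /set2P B : b \in [set c; d] by rewrite -E set22.
have /set2P C : c \in [set a; b] by rewrite E set21.
have /set2P D : d \in [set a; b] by rewrite E set22.
by case: A B C D => ? [] ? [] ? [] ?;
  ((left; split; congruence) || (right; split; congruence)).
Qed.

(** [d] is the distance from [x], and [par u] is the last vertex but one of a shortest path to
    [u]. *)
Lemma bfs_parent (V : finType) (e : rel V) (x : V) :
  exists d : V -> nat, exists par : V -> V, forall u, connect e x u -> u != x ->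
    [/\ connect e x (par u), e (par u) u & d (par u) < d u].
Proof.
have dP u : exists n, connect e x u ->
    (exists p, [/\ path e x p, last x p = u & size p = n]) /\
    (forall p, path e x p -> last x p = u -> n <= size p).
  have [/connectP[p0 p0P p0u]|nc] := boolP (connect e x u); last by exists 0.
  pose P n := [exists p : n.-tuple V, path e x p && (last x p == u)].
  have exP : exists n, P n.
    by exists (size p0); apply/existsP; exists (in_tuple p0); rewrite p0P -p0u eqxx.
  case: (ex_minnP exP) => n /existsP[p /andP[pP /eqP pu]] mn; exists n => _; split.
    by exists p; rewrite size_tuple.
  move=> q qP qu; apply: mn; apply/existsP; exists (in_tuple q).
  by rewrite qP qu eqxx.
have [d dE] := fin_all_exists dP; exists d.
apply: (@fin_all_exists V (fun=> V) (fun u v => connect e x u -> u != x ->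
  [/\ connect e x v, e v u & d v < d u])) => u; have [c|nc] := boolP (connect e x u); last by exists u.
have [ux|ux] := eqVneq u x; first by exists u.
have [[p [pP pu sp]] _] := dE u c.
case/lastP: p => [|p w] in pP pu sp; first by rewrite -pu eqxx in ux.
move: pP pu sp; rewrite rcons_path last_rcons size_rcons => /andP[pP pw] wu sp; subst w.
exists (last x p) => _ _; have cl : connect e x (last x p) by apply/connectP; exists p.
by split=> //; have [_ mn] := dE _ cl; rewrite -sp ltnS mn.
Qed.

(** The edges join each vertex to its parent. On a cycle, both neighbours of a vertex of largest [d]
    would have to be its parent, but they are distinct. *)
Lemma spanning_tree n (e : rel (vert n)) x :
  symmetric e -> (forall u v, e u v -> dc_adj u v) ->
  exists ET : {set {set vert n}},
    is_subtree [set u | connect e x u] ET /\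
    (forall E, E \in ET -> exists u v, E = [set u; v] /\ e u v).
Proof.
move=> sym adj; have [d [par parP]] := bfs_parent e x.
set VT := [set u | connect e x u].
pose ET := [set [set u; par u] | u in VT :\ x].
have ETP E : E \in ET -> exists u, [/\ E = [set u; par u], u != x & connect e x u].
  by case/imsetP=> u; rewrite !inE => /andP[ux c] ->; exists u.
have edge u : u != x -> connect e x u -> edge_rel ET u (par u).
  by move=> ux c; apply: imset_f; rewrite !inE ux.
have esym : symmetric (edge_rel ET) by move=> u v; rewrite /edge_rel setUC.
exists ET; split; last first.
  by move=> E /ETP[u [-> ux /parP/(_ ux)[_ eu _]]]; exists u, (par u); rewrite sym.
split.
- move=> E /ETP[u [-> ux c]]; have [cp eu _] := parP u c ux.
  by exists u, (par u); rewrite !inE c cp adj // sym.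
- by apply/set0Pn; exists x; rewrite inE.
- have cx u : connect e x u -> connect (edge_rel ET) x u.
    have [k] := ubnP (d u); elim: k u => // k IH u ltk c.
    have [->|ux] := eqVneq u x; first exact: connect0.
    have [cp _ ltd] := parP u c ux.
    apply: connect_trans (IH _ _ cp) _; first exact: leq_trans ltd _.
    by apply: connect1; rewrite esym edge.
  move=> u v; rewrite !inE => cu cv; apply: connect_trans (cx _ cv).
  by rewrite (sym_connect_sym esym) cx.
move=> c uc sc; apply/negP => cyc.
have [u uC umax] : exists2 u, u \in c & forall v, v \in c -> d v <= d u.
  case: c sc {uc cyc} => // a c _; pose P v := v \in a :: c.
  case: (@arg_maxnP _ a P d) => [|u uP umax]; first exact: mem_head.
  by exists u.
have [i c' rc] := rot_to uC.
have uc' : uniq (u :: c') by rewrite -rc rot_uniq.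
have mc' v : v \in u :: c' -> d v <= d u by rewrite -rc mem_rot; apply: umax.
have cyc' : cycle (edge_rel ET) (u :: c') by rewrite -rc rot_cycle.
have sc' : 1 < size c' by have := congr1 size rc; rewrite size_rot => szc; rewrite szc in sc.
have nbP v : v \in c' -> edge_rel ET u v -> v = par u.
  move=> vc /ETP[t [/set2_inj[[<- ->]|[ut vt]] tx ct]] //.
  have [_ _] := parP t ct tx; rewrite -ut -vt ltnNge mc' // inE vc orbT //.
case: c' sc' uc' cyc' nbP {rc mc'} => // v c'.
case/lastP: c' => // c' w _ uc' cyc' nbP.
move: cyc'; rewrite /= rcons_path last_rcons => /and3P[uv _ wu].
have v1 := nbP v (mem_head _ _) uv.
have w1 : w = par u by apply: nbP; rewrite 1?esym // inE mem_rcons mem_head orbT.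
by move: uc'; rewrite v1 w1 /= mem_rcons mem_head andbF.
Qed.

(** The trees span the components of [x] in the relations [e i]. A vertex outside S in such a
    component lies on an edge of [e i], and all its edges belong to one relation only. *)
Lemma packing n m (S : {set vert n}) x (e : nat -> rel (vert n)) :
  x \in S -> (forall i, symmetric (e i)) ->
  (forall i u v, e i u v -> dc_adj u v) ->
  (forall i j u v, e i u v -> e j u v -> i = j) ->
  (forall i j u v w, u \notin S -> e i u v -> e j u w -> i = j) ->
  (forall i s, i < m -> s \in S -> connect (e i) x s) ->
  exists T : 'I_m -> {set vert n} * {set {set vert n}},
    internally_disjoint_Strees S T.
Proof.
move=> xS sym adj edj vdj con.
have [ET ETP] := fin_all_exists (fun i : 'I_m => spanning_tree x (sym i) (adj i)).
exists (fun i : 'I_m => ([set u | connect (e i) x u], ET i)); split=> [i|i j ij] /=.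
  have [tree _] := ETP i; split=> //; apply/subsetP => s sS.
  by rewrite inE con.
split.
  apply/setP => E; rewrite !inE; apply/negP => /andP[Ei Ej].
  have [_ /(_ _ Ei)[u [v [uv ei]]]] := ETP i.
  have [_ /(_ _ Ej)[u' [v' [uv' ej]]]] := ETP j.
  suff ej' : e j u v by rewrite (val_inj (edj _ _ _ _ ei ej')) eqxx in ij.
  by move: uv'; rewrite uv => /set2_inj[[-> ->]|[-> ->]]; rewrite // sym.
have last_edge k u : connect (e k) x u -> u != x -> exists v, e k u v.
  move=> c ux; have [d [par /(_ u c ux)[_ eu _]]] := bfs_parent (e k) x.
  by exists (par u); rewrite sym.
apply/setP => u; rewrite !inE; apply/andP/idP => [[ci cj]|uS]; last by rewrite !con.
apply: contraNT ij => uS; have ux : u != x by apply: contraNneq uS => ->.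
have [v ei] := last_edge i u ci ux; have [w ej] := last_edge j u cj ux.
by apply/eqP/val_inj/(vdj _ _ u v w).
Qed.

(** * Coordinates of the dual cube *)

Lemma dc_adjC n : symmetric (@dc_adj n).
Proof.
move=> u v; apply: eq_existsb => i; congr (_ && _).
  by apply: eq_forallb => j; rewrite [u j == _]eq_sym.
by rewrite andbC [lastbit u && _]andbC.
Qed.

Section Coordinates.
Variable m : nat.
Implicit Types (u v : vert m.+1) (A B o t p q : pt).

Definition vx (c : bool) A B : vert m.+1 :=
  [ffun i : 'I_(m.+1.*2.-1) => if i < m then nth false A i
     else if i < m.*2 then nth false B (i - m) else c].

(* The vertex of class [c] in the cluster named [o], at position [t] inside it. *)
Definition node (c : bool) o t := if c then vx c o t else vx c t o.

Definition lower u : pt := mkseq (bit u) m.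
Definition upper u : pt := mkseq (fun k => bit u (m + k)) m.
Definition own u := if lastbit u then lower u else upper u.
Definition lab u := if lastbit u then upper u else lower u.

Lemma bit_lt u k (lt : k < m.*2.+1) : bit u k = u (Ordinal lt).
Proof. by rewrite /bit insubT. Qed.

Lemma bit_ord u (i : 'I_(m.+1.*2.-1)) : bit u i = u i.
Proof. by rewrite (bit_lt u (ltn_ord i : i < m.*2.+1)); congr (u _); apply: val_inj. Qed.

Let doubleE : m.+1.*2 - 2 = m.*2. Proof. by rewrite doubleS subn2. Qed.

Lemma vxE c A B (k : nat) : k < m.*2.+1 ->
  bit (vx c A B) k = if k < m then nth false A k
    else if k < m.*2 then nth false B (k - m) else c.
Proof. by move=> lt; rewrite bit_lt ffunE. Qed.

Lemma lastbitE u : lastbit u = bit u m.*2.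
Proof. by rewrite /lastbit doubleE. Qed.

Lemma lastbit_vx c A B : lastbit (vx c A B) = c.
Proof. by rewrite lastbitE vxE // ltnNge -addnn leq_addr /= ltnn. Qed.

Lemma lower_vx c A B : size A = m -> lower (vx c A B) = A.
Proof.
move=> sA; apply: (@eq_from_nth _ false) => [|k]; rewrite size_mkseq ?sA // => lt.
by rewrite nth_mkseq // vxE ?lt // ltnS -addnn ltnW // ltn_addr.
Qed.

Lemma upper_vx c A B : size B = m -> upper (vx c A B) = B.
Proof.
move=> sB; apply: (@eq_from_nth _ false) => [|k]; rewrite size_mkseq ?sB // => lt.
rewrite nth_mkseq // vxE; last by rewrite ltnS -addnn leq_add2l ltnW.
by rewrite ltnNge leq_addr /= -addnn ltn_add2l lt addKn.
Qed.

Lemma vx_coord u : vx (lastbit u) (lower u) (upper u) = u.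
Proof.
apply/ffunP => i; rewrite ffunE; have lti : i < m.*2.+1 := ltn_ord i.
have bi := bit_ord u i.
case: ltnP => [lt|ge]; first by rewrite nth_mkseq.
case: ltnP => [lt|ge2]; last by rewrite lastbitE -bi; congr bit; apply/eqP; rewrite eqn_leq ge2 -ltnS.
by rewrite nth_mkseq ?subnKC // ltn_subLR // addnn.
Qed.

Lemma lastbit_node c o t : lastbit (node c o t) = c.
Proof. by case: c; rewrite lastbit_vx. Qed.

Lemma own_node c o t : size o = m -> own (node c o t) = o.
Proof. by move=> so; rewrite /own lastbit_node; case: c; rewrite ?lower_vx ?upper_vx. Qed.

Lemma lab_node c o t : size t = m -> lab (node c o t) = t.
Proof. by move=> st; rewrite /lab lastbit_node; case: c; rewrite ?lower_vx ?upper_vx. Qed.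

Lemma size_own u : size (own u) = m.
Proof. by rewrite /own; case: ifP; rewrite size_mkseq. Qed.

Lemma size_lab u : size (lab u) = m.
Proof. by rewrite /lab; case: ifP; rewrite size_mkseq. Qed.

Lemma node_coord u : node (lastbit u) (own u) (lab u) = u.
Proof. by rewrite -{4}(vx_coord u) /node /own /lab; case: (lastbit u). Qed.

Lemma adj_vx c c' A A' B B' k : k < m.*2.+1 ->
  (forall j, j < m.*2.+1 -> (bit (vx c A B) j != bit (vx c' A' B') j) = (j == k)) ->
  (if k < m then ~~ c && ~~ c' else if k < m.*2 then c && c' else true) ->
  dc_adj (vx c A B) (vx c' A' B').
Proof.
move=> lt E cond; apply/existsP; exists (Ordinal lt : 'I_(m.+1.*2.-1)).
rewrite !lastbit_vx subn1 doubleE /= cond andbT.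
by apply/forallP => j; rewrite -!bit_ord E ?ltn_ord.
Qed.

Lemma adj_flip c o t d : size t = m -> d < m ->
  dc_adj (node c o t) (node c o (flip d t)).
Proof.
move=> st lt; case: c; rewrite /node.
- apply: (@adj_vx _ _ _ _ _ _ (m + d)); first by rewrite ltnS -addnn leq_add2l ltnW.
    move=> j ltj; rewrite !vxE //; case: ltnP => [jm|mj].
      by rewrite eqxx; apply/esym/negbTE; rewrite neq_ltn (leq_trans jm) // leq_addr.
    case: ltnP => [j2|j2]; last first.
      rewrite eqxx; apply/esym/negbTE; rewrite neq_ltn orbC.
      by rewrite (leq_trans _ j2) // -addnn ltn_add2l.
    have -> : (j == m + d) = (j - m == d) by rewrite -(eqn_add2l m (j - m)) subnKC.
    rewrite nth_flip ?st ?ltn_subLR ?addnn //.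
    by case: (nth _ _ _); case: (_ == d).
  by rewrite ltnNge leq_addr /= -addnn ltn_add2l lt.
apply: (@adj_vx _ _ _ _ _ _ d); first by rewrite ltnS -addnn ltnW // ltn_addr.
  move=> j ltj; rewrite !vxE //; case: ltnP => [jm|mj].
    by rewrite nth_flip ?st //; case: (nth _ _ _); case: (_ == d).
  rewrite eqxx; apply/esym/negbTE.
  by rewrite neq_ltn orbC (leq_trans lt mj).
by rewrite lt.
Qed.

Lemma adj_cross c o t : dc_adj (node c o t) (node (~~ c) t o).
Proof.
have cross b A B : dc_adj (vx b A B) (vx (~~ b) A B).
  have gt : (m.*2 < m) = false by apply/negbTE; rewrite -leqNgt -addnn leq_addr.
  apply: (@adj_vx _ _ _ _ _ _ m.*2); rewrite ?gt ?ltnn // => j ltj.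
  rewrite !vxE //; have [jm|mj] := ltnP j m.
    rewrite eqxx; apply/esym/negbTE; rewrite neq_ltn (leq_trans jm) //.
    by rewrite -addnn leq_addr.
  have [j2|j2] := ltnP j m.*2.
    by rewrite eqxx; apply/esym/negbTE; rewrite neq_ltn j2.
  have -> : (j == m.*2) = true by rewrite eqn_leq j2 -ltnS ltj.
  by case: b.
by case: c; apply: cross.
Qed.

Lemma same_clusterE u v : same_cluster u v = (lastbit u == lastbit v) && (own u == own v).
Proof.
rewrite /same_cluster subn1 doubleE /=; case: eqP => //= cE.
rewrite /own -cE; apply/forallP/eqP => [h|E j].
  case: ifP h => c h; apply: (@eq_from_nth _ false) => [|k]; rewrite !size_mkseq // => lt;
    rewrite !nth_mkseq // .
    have lt2 : k < m.*2.+1 by rewrite ltnS -addnn ltnW // ltn_addr.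
    by have := h (Ordinal lt2); rewrite /= lt !(bit_lt _ lt2) => /eqP.
  have lt2 : m + k < m.*2.+1 by rewrite ltnS -addnn leq_add2l ltnW.
  have := h (Ordinal lt2); rewrite /= leq_addr -[X in _ < X]addnn ltn_add2l lt !(bit_lt _ lt2).
  by move/eqP.
apply/implyP; have lt2 : j < m.*2.+1 := ltn_ord j.
rewrite -!bit_ord; case: ifP E => c E.
  by move=> lt; have := congr1 (fun x => nth false x j) E; rewrite !nth_mkseq // => ->.
case/andP=> ge lt; have := congr1 (fun x => nth false x (j - m)) E.
by rewrite !nth_mkseq ?ltn_subLR ?addnn // subnKC // => ->.
Qed.
End Coordinates.

(** * Trees from colourings *)

Lemma size_nhd m p q : q \in nhd m p -> size q = size p.
Proof. by case/mem_nhd => [->|[d _ ->]] //; rewrite size_flip. Qed.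

(** The coordinates of [t] are replaced by those of [t'] one at a time; [mix k] has the first [k]
    replaced. *)
Lemma flip_ind m (P : pt -> Prop) t t' :
  size t = m -> size t' = m -> P t ->
  (forall d s, size s = m -> d < m -> P s -> P (flip d s)) -> P t'.
Proof.
move=> st st' Pt Pf.
pose mix k := mkseq (fun j => if j < k then nth false t' j else nth false t j) m.
have mixE k j : j < m -> nth false (mix k) j = if j < k then nth false t' j else nth false t j.
  by move=> lt; rewrite nth_mkseq.
have sm k : size (mix k) = m by rewrite size_mkseq.
have Pmix k : k <= m -> P (mix k).
  elim: k => [_|k IH lt].
    suff -> : mix 0 = t by [].
    by apply: (@eq_from_nth _ false) => [|j]; rewrite sm // => ltj; rewrite mixE.
  have Pk := IH (ltnW lt).
  have [E|ne] := eqVneq (nth false t k) (nth false t' k).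
    suff -> : mix k.+1 = mix k by [].
    apply: (@eq_from_nth _ false) => [|j]; rewrite !sm // => ltj; rewrite !mixE //.
    by rewrite ltnS leq_eqVlt; case: eqP => [->|] //=; rewrite ltnn E.
  suff -> : mix k.+1 = flip k (mix k) by apply: Pf.
  apply: (@eq_from_nth _ false) => [|j]; rewrite ?size_flip !sm // => ltj.
  rewrite nth_flip ?sm // !mixE // ltnS leq_eqVlt; case: eqP => [->|] /=; last by rewrite addbF.
  by rewrite ltnn; move: ne; case: (nth _ t _); case: (nth _ t' _).
suff -> : t' = mix m by apply: Pmix.
by apply: (@eq_from_nth _ false) => [|j]; rewrite ?sm // st' => ltj; rewrite mixE // ltj.
Qed.

Lemma find_flip m d t : size t = m -> d < m ->
  find (fun k => nth false t k != nth false (flip d t) k) (iota 0 m) = d.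
Proof.
move=> st lt; have d_iota : d \in iota 0 m by rewrite mem_iota.
transitivity (index d (iota 0 m)).
  apply: eq_in_find => k; rewrite mem_iota => /= ltk.
  by rewrite nth_flip ?st //=; case: (nth _ _ _); case: (_ == d).
have nd : nth 0 (iota 0 m) d = d by rewrite nth_iota.
by rewrite -{1}nd index_uniq ?size_iota ?iota_uniq.
Qed.

Section Colouring.
Variables (m : nat) (S : {set vert m.+1}) (spec : bool -> pred pt).
Variables (F : bool -> pt -> nat) (G : bool -> nat -> nat).
Implicit Types (u v s : vert m.+1) (o t p q : pt) (c : bool).

(** A vertex of a special cluster takes the colour of the name across its cross edge, even if that
    name is itself special; this is how a vertex facing the hole gets a colour. *)
Definition colour u :=
  if spec (lastbit u) (own u) then F (~~ lastbit u) (lab u) else F (lastbit u) (own u).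

(** The conjunction of the last bits keeps the value symmetric; on an edge inside a cluster it is
    the class. *)
Definition edge_colour u v :=
  G (lastbit u && lastbit v)
    (find (fun k => nth false (lab u) k != nth false (lab v) k) (iota 0 m)).

(** Vertices of S belong to every colour, so an edge between two of them would lie in all relations;
    [edge_colour] assigns it to a single one. *)
Definition cedge i u v :=
  dc_adj u v && (if (u \in S) && (v \in S) then edge_colour u v == i
    else ((u \in S) || (colour u == i)) && ((v \in S) || (colour v == i))).

Lemma cedgeC i : symmetric (cedge i).
Proof.
move=> u v; rewrite /cedge dc_adjC [(v \in S) && _]andbC; congr (_ && _).
case: ifP => _; last by rewrite andbC.
rewrite /edge_colour andbC; congr (G _ _ == _).
by apply: eq_find => k; rewrite eq_sym.
Qed.

Lemma cedge_inj i j u v : cedge i u v -> cedge j u v -> i = j.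
Proof.
case/andP=> _ H /andP[_]; move: H; case: ifP => [_ /eqP<- /eqP<- //|].
case: (u \in S) => /= [->|_] /=; first by move=> /eqP<- /eqP.
by case/andP=> /eqP<- _ /andP[/eqP<-].
Qed.

Lemma cedge_vertex i j u v w : u \notin S -> cedge i u v -> cedge j u w -> i = j.
Proof.
by rewrite /cedge => /negbTE-> /= /and3P[_ /eqP<- _] /and3P[_ /eqP<-].
Qed.

Lemma cedgeI i u v : dc_adj u v -> ~~ ((u \in S) && (v \in S)) ->
  (u \in S) || (colour u == i) -> (v \in S) || (colour v == i) -> cedge i u v.
Proof. by rewrite /cedge => -> /negbTE-> -> ->. Qed.

Hypothesis specS : forall s, s \in S -> spec (lastbit s) (own s).
Hypothesis free : forall c i, i < m -> exists o, [/\ size o = m, ~~ spec c o & F c o = i].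

Lemma node_notin c o t : size o = m -> ~~ spec c o -> node m c o t \notin S.
Proof.
by move=> so; apply: contra => /specS; rewrite lastbit_node own_node.
Qed.

Lemma colour_free c o t : size o = m -> ~~ spec c o -> colour (node m c o t) = F c o.
Proof. by move=> so /negbTE no; rewrite /colour lastbit_node own_node // no. Qed.

Lemma colour_spec c o t : size o = m -> size t = m -> spec c o ->
  colour (node m c o t) = F (~~ c) t.
Proof. by move=> so st sp; rewrite /colour lastbit_node own_node // sp lab_node. Qed.

Lemma connectC i u v : connect (cedge i) u v -> connect (cedge i) v u.
Proof. by rewrite (sym_connect_sym (@cedgeC i)). Qed.

Lemma connect_cluster c o t t' : size o = m -> size t = m -> size t' = m -> ~~ spec c o ->
  connect (cedge (F c o)) (node m c o t) (node m c o t').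
Proof.
move=> so st st' no; apply: (@flip_ind m (fun r => connect (cedge (F c o)) (node m c o t) (node m c o r)) t t') => // d s ss lt con.
apply: connect_trans con _; apply: connect1; apply: cedgeI.
- exact: adj_flip.
- by rewrite (negbTE (node_notin _ so no)).
- by rewrite colour_free ?eqxx ?orbT.
by rewrite colour_free ?eqxx ?orbT.
Qed.

Lemma connect_cross c o t : size o = m -> size t = m ->
  ~~ spec (~~ c) t -> node m c o t \in S \/ colour (node m c o t) = F (~~ c) t ->
  connect (cedge (F (~~ c) t)) (node m c o t) (node m (~~ c) t o).
Proof.
move=> so st nt H; apply: connect1; apply: cedgeI; first exact: adj_cross.
- by rewrite (negbTE (node_notin _ st nt)) andbF.
- by case: H => [->|->]; rewrite ?eqxx ?orbT.
by rewrite colour_free ?eqxx ?orbT.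
Qed.

(** Clusters of different classes are joined by their cross edge. For clusters of the same class,
    [free] provides one of colour [i] in the other class as an intermediate stop. *)
Lemma connect_clusters i c c' o o' t t' :
  i < m -> size o = m -> size o' = m -> size t = m -> size t' = m ->
  ~~ spec c o -> ~~ spec c' o' -> F c o = i -> F c' o' = i ->
  connect (cedge i) (node m c o t) (node m c' o' t').
Proof.
move=> ltm so so' st st' no no' Fo Fo'.
have other b a a' r r' : size a = m -> size a' = m -> size r = m -> size r' = m ->
    ~~ spec b a -> ~~ spec (~~ b) a' -> F b a = i -> F (~~ b) a' = i ->
    connect (cedge i) (node m b a r) (node m (~~ b) a' r').
  move=> sa sa' sr sr' na na' Fa Fa'.
  apply: (@connect_trans _ _ (node m b a a')); first by rewrite -Fa connect_cluster.
  apply: (@connect_trans _ _ (node m (~~ b) a' a)); last by rewrite -Fa' connect_cluster.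
  by rewrite -Fa' connect_cross // colour_free // Fa Fa'; right.
case: (eqVneq c' c) => [E|ne]; last first.
  have E : c' = ~~ c by case: (c) (c') ne => [] [].
  by rewrite E in no' Fo' *; apply: other.
rewrite E in no' Fo' *; have [a [sa na Fa]] := free (~~ c) ltm.
apply: (@connect_trans _ _ (node m (~~ c) a o)); first exact: other.
by apply: connectC; apply: other.
Qed.

(** The route goes from [p] to [q], on to an exit [u] if [q] faces the hole, and then over the cross
    edge into a cluster of colour [i]. *)
Lemma direct_connect i c o p c' o' t' :
  i < m -> size o = m -> size p = m -> size o' = m -> size t' = m ->
  spec c o -> ~~ spec c' o' -> F c' o' = i -> node m c o p \in S ->
  direct m (F (~~ c)) (fun q => node m c o q \in S) (spec (~~ c)) p i ->
  connect (cedge i) (node m c o p) (node m c' o' t').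
Proof.
move=> ltm so sp so' st' sco no' Fo' pS /hasP[q qN]; case: eqP => // Fq /andP[qE ex].
have sq := size_nhd qN; rewrite sp in sq.
have exit r : size r = m -> ~~ spec (~~ c) r -> F (~~ c) r = i ->
    connect (cedge i) (node m c o r) (node m c' o' t').
  move=> sr nr Fr; apply: (@connect_trans _ _ (node m (~~ c) r o)).
    by rewrite -Fr connect_cross // colour_spec //; right.
  exact: connect_clusters.
have step r r' : size r = m -> r' \in nhd m r -> node m c o r' \notin S ->
    F (~~ c) r' = i -> node m c o r \in S \/ F (~~ c) r = i ->
    connect (cedge i) (node m c o r) (node m c o r').
  move=> sr /mem_nhd[-> //|[d ltd r'E]] nr' Fr' H; apply: connect1; apply: cedgeI.
  - by rewrite r'E adj_flip.
  - by rewrite (negbTE nr') andbF.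
  - by case: H => [->|Fr] //; rewrite colour_spec // Fr eqxx orbT.
  by rewrite colour_spec ?Fr' ?eqxx ?orbT // r'E size_flip.
apply: (@connect_trans _ _ (node m c o q)).
  by case/orP: qE => [/eqP-> //|qS]; apply: step => //; left.
move: ex; rewrite /exits; case: ifP => [_ /hasP[u uN /and3P[uS nu /eqP Fu]]|/negbT nq _]; last first.
  exact: exit.
have su : size u = m by rewrite (size_nhd uN).
apply: (@connect_trans _ _ (node m c o u)); last exact: exit.
by apply: step => //; right.
Qed.

Lemma served_connect i c o p c' o' t' :
  i < m -> size o = m -> size p = m -> size o' = m -> size t' = m ->
  spec c o -> ~~ spec c' o' -> F c' o' = i -> node m c o p \in S ->
  served m (F (~~ c)) (G c) (fun q => node m c o q \in S) (spec (~~ c)) p i ->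
  connect (cedge i) (node m c o p) (node m c' o' t').
Proof.
move=> ltm so sp so' st' sco no' Fo' pS.
rewrite /served; case: ifP => [dir _|_ /hasP[d]]; first by apply: direct_connect.
rewrite mem_iota add0n => /= ltd; case: ifP => // fS; case: eqP => // gd dir.
have sf : size (flip d p) = m by rewrite size_flip.
apply: (@connect_trans _ _ (node m c o (flip d p))); last by apply: direct_connect.
apply: connect1; rewrite /cedge adj_flip // pS fS /= /edge_colour !lastbit_node andbb.
by rewrite !lab_node // find_flip // gd.
Qed.

Theorem trees_of_labelling x : x \in S ->
  (forall s i, s \in S -> i < m ->
     served m (F (~~ lastbit s)) (G (lastbit s))
       (fun q => node m (lastbit s) (own s) q \in S) (spec (~~ lastbit s)) (lab s) i) ->
  exists T : 'I_m -> {set vert m.+1} * {set {set vert m.+1}},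
    internally_disjoint_Strees S T.
Proof.
move=> xS sv; apply: (@packing _ _ S x cedge) => //.
- exact: cedgeC.
- by move=> i u v /andP[].
- exact: cedge_inj.
- exact: cedge_vertex.
move=> i s lt sS; have [o [so no Fo]] := free false lt.
(* All of S is joined to one vertex of a cluster of colour [i]; its position there is arbitrary, and
   [o] has the right length. *)
have hub v : v \in S -> connect (cedge i) v (node m false o o).
  move=> vS; rewrite -(node_coord v); apply: served_connect => //.
  - exact: size_own.
  - exact: size_lab.
  - exact: specS.
  - by rewrite node_coord.
  exact: sv.
by apply: connect_trans (hub x xS) (connectC (hub s sS)).
Qed.
End Colouring.

Lemma served_eq m f g (X X' H H' : pred pt) p i :
  (forall q, size q = m -> X q = X' q) -> (forall q, size q = m -> H q = H' q) ->
  (forall q, H q -> size q = m) -> size p = m ->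
  served m f g X' H' p i -> served m f g X H p i.
Proof.
move=> XE HE Hm sp.
apply: (@served_lift _ _ _ _ _ _ _ _ _ _ (fun q => size q == m) id id) => //.
- by move=> q /eqP sq; split; rewrite ?XE ?HE.
- by move=> q /Hm/eqP.
- by move=> q d; rewrite size_flip.
- by move=> q d /eqP sq lt; split=> //; split; rewrite ?XE ?HE ?size_flip.
exact/eqP.
Qed.

(** Supplies the hypothesis [free]: a path that serves [p] ends at a point of colour [i] outside the
    hole. *)
Lemma served_free m f g X H p i : size p = m -> served m f g X H p i ->
  exists q, [/\ size q = m, ~~ H q & f q = i].
Proof.
have dir r : size r = m -> direct m f X H r i -> exists q, [/\ size q = m, ~~ H q & f q = i].
  move=> sr /hasP[q qN]; case: eqP => // fq /andP[_].
  have sq := size_nhd qN; rewrite sr in sq.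
  rewrite /exits; case: ifP => [_ /hasP[u uN /and3P[_ Hu /eqP fu]]|/negbT Hq _]; last by exists q.
  by exists u; rewrite (size_nhd uN).
move=> sp; rewrite /served; case: ifP => [d _|_ /hasP[d _]]; first exact: dir d.
by case: ifP => // _; case: ifP => // _; apply: dir; rewrite size_flip.
Qed.

(** * Colourings for four vertices in two clusters *)

Lemma solvableC m X1 X2 H : solvable m X1 X2 H -> solvable m X2 X1 H.
Proof.
by case=> f [g sol]; exists f, g => i p lt; have [h1 h2] := sol i p lt; split.
Qed.

Lemma solvable_lists m (X1 X2 H : seq pt) :
  2 < m -> (size X1, size X2, size H) \in shapes -> uniq X1 -> uniq X2 ->
  (forall p, p \in X1 ++ X2 ++ H -> size p = m) -> solvable m X1 X2 H.
Proof.
move=> m2 sh u1 u2 sz.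
have d1 : drop (size X1) (X1 ++ X2 ++ H) = X2 ++ H by rewrite drop_size_cat.
have prop : well_shaped m (size X1) (size X2) (size H) (X1 ++ X2 ++ H).
  split; rewrite ?d1 ?take_size_cat ?size_cat ?addnA //.
  by apply/allP => p /sz/eqP.
have := solvable_shapes m2 sh prop; rewrite /solvable_at d1 !take_size_cat //.
by rewrite catA drop_size_cat // size_cat.
Qed.

(** For two special clusters of one class, all cross neighbours lie in the other class, where no
    cluster is special: there is no hole, but one colouring must serve both sets. *)
Lemma solvable_same_class m (X1 X2 : seq pt) :
  2 < m -> uniq X1 -> uniq X2 -> (forall p, p \in X1 ++ X2 -> size p = m) ->
  0 < size X1 -> 0 < size X2 -> size X1 + size X2 = 4 -> solvable m X1 X2 [::].
Proof.
move=> m2 u1 u2 sz p1 p2 s4.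
wlog le : X1 X2 u1 u2 sz p1 p2 s4 / size X2 <= size X1.
  move=> W; have [le|/ltnW le] := leqP (size X2) (size X1); first exact: W.
  by apply: solvableC; apply: W; rewrite 1?addnC // => p; rewrite mem_cat orbC -mem_cat; apply: sz.
apply: solvable_lists => //; last by rewrite cats0.
move: (size X1) (size X2) p1 p2 s4 le => a b {u1 u2 sz}.
by case: a b => [|[|[|[|[|a]]]]] [|[|[|[|[|b]]]]].
Qed.

(** Special clusters of different classes are treated separately: each is served by a colouring of
    the opposite class, in which the name [a] of the other one is the hole. *)
Lemma solvable_hole m (X1 : seq pt) a :
  2 < m -> uniq X1 -> (forall p, p \in X1 -> size p = m) -> size a = m ->
  0 < size X1 -> size X1 <= 3 -> solvable m X1 [::] [:: a].
Proof.
move=> m2 u1 sz sa p1 p3; apply: solvable_lists => //.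
  by case: (size X1) p1 p3 => [|[|[|[|b]]]].
by move=> p; rewrite mem_cat inE => /orP[/sz|/eqP->].
Qed.

Fixpoint all_pts m : seq pt :=
  if m is m'.+1 then [seq b :: p | b <- [:: false; true], p <- all_pts m'] else [:: [::]].

Lemma all_pts_uniq m : uniq (all_pts m).
Proof.
elim: m => //= m IH; rewrite cats0 cat_uniq !map_inj_uniq ?IH ?andbT //=; try by move=> p q [].
by apply/hasPn => p /mapP[q _ ->]; apply/mapP => -[].
Qed.

Lemma size_all_pts m : size (all_pts m) = 2 ^ m.
Proof. by elim: m => //= m IH; rewrite cats0 size_cat !size_map IH expnS mul2n addnn. Qed.

Lemma mem_all_pts m p : p \in all_pts m -> size p = m.
Proof.
elim: m p => [|m IH] p; first by rewrite inE => /eqP->.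
by case/allpairsP=> -[b q] /= [_ /IH <- ->].
Qed.

(** Meant for the class that contains both special clusters: it only has to show every colour away
    from two names, and [2 ^ m - 2] is at least [m]. *)
Lemma enough_points m (a : seq pt) : size a = 2 -> 2 < m ->
  exists K : pt -> nat, forall i, i < m -> exists o, [/\ size o = m, o \notin a & K o = i].
Proof.
move=> sa m2; pose L := [seq o <- all_pts m | o \notin a].
have mL : m <= size L.
  have : size [seq o <- all_pts m | o \in a] <= 2.
    rewrite -sa; apply: uniq_leq_size; first by rewrite filter_uniq ?all_pts_uniq.
    by move=> o; rewrite mem_filter => /andP[].
  have := count_predC (fun o => o \in a) (all_pts m); rewrite -!size_filter size_all_pts -/L.
  move=> sum le; rewrite -(leq_add2l 2); apply: leq_trans (_ : 2 ^ m <= _); last first.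
    by rewrite -sum leq_add2r.
  elim: m m2 {L sum le} => // -[|[|[|m]]] // IH _.
  by rewrite addnS -addn1 [2 ^ _]expnS mul2n -addnn leq_add ?IH ?expn_gt0.
exists (fun o => index o L) => i lt; have ltL := leq_trans lt mL.
exists (nth [::] L i); have := mem_nth [::] ltL; rewrite mem_filter => /andP[na /mem_all_pts].
by split=> //; rewrite index_uniq // filter_uniq // all_pts_uniq.
Qed.

Section Keys.
Variables (m : nat) (S : {set vert m.+1}).

Definition key (u : vert m.+1) := (lastbit u, own u).
Definition labels k := [seq lab u | u <- enum S & key u == k].

Lemma mem_labels k p : size k.2 = m -> size p = m ->
  (p \in labels k) = (node m k.1 k.2 p \in S).
Proof.
move=> sk sp; apply/mapP/idP => [[u]|nS].
  by rewrite mem_filter mem_enum => /andP[/eqP<- uS ->] /=; rewrite node_coord.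
exists (node m k.1 k.2 p); last by rewrite lab_node.
by rewrite mem_filter mem_enum nS /key lastbit_node own_node // -surjective_pairing eqxx.
Qed.

Lemma labels_uniq k : uniq (labels k).
Proof.
rewrite map_inj_in_uniq; first by rewrite filter_uniq ?enum_uniq.
move=> u v.
rewrite !mem_filter => /andP[/eqP ku _] /andP[/eqP kv _] E.
have [cE oE] : lastbit u = lastbit v /\ own u = own v by split; move: ku; rewrite -kv => -[].
by rewrite -(node_coord u) -(node_coord v) cE oE E.
Qed.

Lemma size_labels k p : p \in labels k -> size p = m.
Proof. by case/mapP=> u _ ->; apply: size_lab. Qed.

Lemma labels_card k1 k2 : k1 != k2 -> (forall s, s \in S -> key s \in [:: k1; k2]) ->
  size (labels k1) + size (labels k2) = #|S|.
Proof.
move=> ne SK; rewrite !size_map !size_filter cardE -(count_predC (fun u => key u == k1)).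
congr addn; apply: eq_in_count => u; rewrite mem_enum => /SK; rewrite !inE /=.
by case/orP=> /eqP->; rewrite eqxx ?(negbTE ne) // eq_sym (negbTE ne).
Qed.

Lemma trees_of_keys x (k1 k2 : bool * pt) (F : bool -> pt -> nat) (G : bool -> nat -> nat) :
  x \in S -> (forall s, s \in S -> key s \in [:: k1; k2]) ->
  size k1.2 = m -> size k2.2 = m ->
  (forall c i, i < m -> exists o, [/\ size o = m, (c, o) \notin [:: k1; k2] & F c o = i]) ->
  (forall k p i, k \in [:: k1; k2] -> p \in labels k -> i < m ->
     served m (F (~~ k.1)) (G k.1) (mem (labels k))
       (fun o => (~~ k.1, o) \in [:: k1; k2]) p i) ->
  exists T : 'I_m -> {set vert m.+1} * {set {set vert m.+1}},
    internally_disjoint_Strees S T.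
Proof.
move=> xS SK s1 s2 free sv.
apply: (@trees_of_labelling m S (fun c o => (c, o) \in [:: k1; k2]) F G _ _ x) => //.
  by move=> s i sS lt; apply: (@served_eq _ _ _ _ (mem (labels (key s))) _
      (fun o => (~~ lastbit s, o) \in [:: k1; k2])) => //;
    [ by move=> q sq; rewrite -(@mem_labels (key s)) // size_own
    | by move=> q; rewrite !inE => /orP[] /eqP E; [rewrite -s1 -E | rewrite -s2 -E]
    | exact: size_lab
    | apply: (sv (key s)) => //; [exact: SK | apply: map_f; rewrite mem_filter eqxx mem_enum]].
Qed.
End Keys.

Lemma cluster_eq m (u v : vert m.+1) : cluster u = cluster v -> key u = key v.
Proof.
move=> E; have : v \in cluster u by rewrite E inE same_clusterE !eqxx.
by rewrite inE same_clusterE /key => /andP[/eqP-> /eqP->].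
Qed.

Lemma trees_two_clusters m (S : {set vert m.+1}) :
  2 < m -> #|S| = 4 -> #|[set cluster u | u in S]| = 2 ->
  exists T : 'I_m -> {set vert m.+1} * {set {set vert m.+1}},
    internally_disjoint_Strees S T.
Proof.
move=> m2 S4 two; have /cards2P[C1 [C2 [ne CE]]] : #|[set cluster u | u in S]| == 2 by rewrite two.
have [u1 u1S C1E] : exists2 u, u \in S & C1 = cluster u by apply/imsetP; rewrite CE set21.
have [u2 u2S C2E] : exists2 u, u \in S & C2 = cluster u by apply/imsetP; rewrite CE set22.
have SK s : s \in S -> key s \in [:: key u1; key u2].
  move=> sS; have : cluster s \in [set C1; C2] by rewrite -CE imset_f.
  by rewrite !inE C1E C2E => /orP[]/eqP/cluster_eq->; rewrite eqxx ?orbT.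
have kne : key u1 != key u2.
  apply: contraNneq ne => -[cE oE]; rewrite C1E C2E; apply/eqP/setP => v.
  by rewrite !inE !same_clusterE cE oE.
have pos u : u \in S -> 0 < size (labels S (key u)).
  by move=> uS; rewrite size_map size_filter -has_count; apply/hasP; exists u; rewrite ?mem_enum.
have sum := labels_card kne SK; rewrite S4 in sum.
have p1 := pos u1 u1S; have p2 := pos u2 u2S.
have ul := labels_uniq S; have sl k p := @size_labels m S k p.
have so1 := size_own u1; have so2 := size_own u2.
move: kne SK sum p1 p2; rewrite /key.
move: (lastbit u1) (own u1) (lastbit u2) (own u2) so1 so2 => c o1 c2 o2 so1 so2.
set k1 := (c, o1); set k2 := (c2, o2) => kne SK sum p1 p2.
have [E|cne] := eqVneq c2 c.
  have [|||||||f [g sol]] := @solvable_same_class m (labels S k1) (labels S k2) => //.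
    by move=> p; rewrite mem_cat => /orP[]; apply: sl.
  have [K KE] := @enough_points m [:: o1; o2] erefl m2.
  (* Positions in clusters of class [c] are names in class [~~ c], so [f] colours the opposite class
     and [K] the class [c] itself. *)
  apply: (@trees_of_keys m S u1 k1 k2 (fun b => if b == c then K else f) (fun=> g)) => //.
    move=> b i lt; case: eqP => [->|/eqP bc].
      have [o [so no Ko]] := KE i lt; exists o; split=> //.
      by move: no; rewrite !inE /k1 /k2 E !xpair_eqE eqxx.
    have [p pX] : exists p, p \in labels S k1 by case: labels p1 => // p l _; exists p; apply: mem_head.
    have [/(_ pX) sv _] := sol i p lt.
    have [q [sq _ fq]] := served_free (sl _ _ pX) sv; exists q; split=> //.
    by rewrite !inE /k1 /k2 E !xpair_eqE (negbTE bc).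
  move=> k p i kK pX lt; have ck : k.1 = c by move: kK; rewrite !inE => /orP[]/eqP->.
  have -> : (~~ k.1 == c) = false by rewrite ck; case: (c).
  apply: (@served_eq _ _ _ _ (mem (labels S k)) _ (mem [::])) => //.
  - by move=> q _; rewrite !inE /k1 /k2 E !xpair_eqE ck; case: (c).
  - by move=> q; rewrite !inE /k1 /k2 E !xpair_eqE ck; case: (c).
  - exact: sl pX.
  have [h1 h2] := sol i p lt.
  by move: kK pX; rewrite !inE => /orP[]/eqP->; [apply: h1 | apply: h2].
have c2E : c2 = ~~ c by case: (c) (c2) cne => [] [].
have hole k o : k \in [:: k1; k2] -> size o = m -> solvable m (labels S k) [::] [:: o].
  move=> kK so; apply: solvable_hole => //.
  - exact: sl.
  - by move: kK; rewrite !inE => /orP[]/eqP->.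
  (* Of the four vertices at least one lies in the other cluster, so at most three remain. *)
  by move: kK; rewrite !inE -ltnS -[4]sum => /orP[]/eqP->; rewrite -addn1 ?leq_add2l // addnC leq_add2r.
have [|f1 [g1 sol1]] := hole k1 o2 _ so2; first exact: mem_head.
have [|f2 [g2 sol2]] := hole k2 o1 _ so1; first by rewrite !inE eqxx orbT.
have ncc : (~~ c == c) = false by case: (c).
(* The vertices in [k1] face class [~~ c], so [f1] colours that class, while the edge colours [g1]
   stay in class [c]; the reverse holds for [k2]. *)
apply: (@trees_of_keys m S u1 k1 k2 (fun b => if b == c then f2 else f1)
  (fun b => if b == c then g1 else g2)) => //.
  have ex k : 0 < size (labels S k) -> exists p, p \in labels S k.
    by case: labels => // p l _; exists p; apply: mem_head.
  move=> b i lt; case: eqP => [->|/eqP bc].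
    have [p pX] := ex _ p2; have [/(_ pX) sv _] := sol2 i p lt.
    have [q [sq nq fq]] := served_free (sl _ _ pX) sv; exists q; split=> //.
    by move: nq; rewrite !inE /k1 /k2 c2E !xpair_eqE eqxx [c == _]eq_sym ncc orbF.
  have [p pX] := ex _ p1; have [/(_ pX) sv _] := sol1 i p lt.
  have [q [sq nq fq]] := served_free (sl _ _ pX) sv; exists q; split=> //.
  by move: nq; rewrite !inE /k1 /k2 c2E !xpair_eqE (negbTE bc) negb_and => ->; rewrite orbT.
move=> k p i kK pX lt.
move: kK pX; rewrite !inE => /orP[]/eqP-> pX /=; rewrite ?c2E ?negbK ?ncc ?eqxx.
  have [/(_ pX) sv _] := sol1 i p lt.
  apply: (@served_eq _ _ _ _ _ _ _ _ _ _ _ _ _ sv) => //.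
  - by move=> q _; rewrite !inE /k1 /k2 c2E !xpair_eqE ncc eqxx.
  - by move=> q; rewrite !inE /k1 /k2 c2E !xpair_eqE ncc eqxx => /eqP->.
  exact: sl pX.
have [/(_ pX) sv _] := sol2 i p lt.
apply: (@served_eq _ _ _ _ _ _ _ _ _ _ _ _ _ sv) => //.
- by move=> q _; rewrite !inE /k1 /k2 c2E !xpair_eqE eqxx [c == _]eq_sym ncc orbF.
- by move=> q; rewrite !inE /k1 /k2 c2E !xpair_eqE eqxx [c == _]eq_sym ncc orbF => /eqP->.
exact: sl pX.
Qed.

Theorem mainTheorem3 (n : nat) (x y z w : vert n) :
  4 <= n ->
  uniq [:: x; y; z; w] ->
  #|[set cluster u | u in [set x; y; z; w]]| = 2 ->
  exists T : 'I_(n - 1) -> {set vert n} * {set {set vert n}},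
    internally_disjoint_Strees [set x; y; z; w] T.
Proof.
case: n x y z w => // m x y z w m3 u4 two.
rewrite subn1; apply: trees_two_clusters => //.
have -> : [set x; y; z; w] = [set u in [:: x; y; z; w]].
  by apply/setP => u; rewrite !inE !orbA.
by rewrite cardsE; apply/card_uniqP.
Qed.
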